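(* Let $\alpha=(\alpha^{(i,k)})\in\mathbb C^n$ be the parameter for the Radon hypergeometric function $F(z,\alpha;C)$ of type $\lambda$. For any parameter $\beta=(\beta^{(1,1)},\dots,\beta^{(1,p_1)},\dots,\beta^{(s,1)},\dots,\beta^{(s,p_s)})\in\mathbb C^n$, $\beta^{(i,k)}=(\beta^{(i,k)}_0,\dots,\beta^{(i,k)}_{n_i-1})\in\mathbb C^{n_i}$, satisfying conditions (i)--(iii) on parameters stated in the context and $\alpha_0^{(i,k)}=\beta_0^{(i,k)}$ ($1\le i\le s$, $1\le k\le p_i$), there exists $g\in U$ such that the change of variables $z\mapsto z'=zg^{-1}$ transforms $F(z,\alpha;C)$ to $F(z',\beta;C)$, i.e. $F(z,\alpha;C)=F(z',\beta;C)$. In particular, one can take $\beta$ as $$\beta^{(i,k)}=(\alpha_0^{(i,k)},0,\dots,0,1)$$ (read as $(\alpha_0^{(i,k)})$ when $n_i=1$).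
   Context: Groups. Let $r,n$ be positive integers, $N=nr$, and $m$ an integer with $r<m<N$. $J_r(p)\subset\mathrm{GL}(pr,\mathbb C)$ is the group of $p\times p$ block matrices with $(a,b)$-block ($r\times r$) equal to $h_{b-a}$ if $b\ge a$ and $0$ otherwise, $h_0\in\mathrm{GL}(r)$, $h_1,\dots,h_{p-1}\in\mathrm{Mat}(r)$. Let $\lambda=(\overbrace{n_1,\dots,n_1}^{p_1},\dots,\overbrace{n_s,\dots,n_s}^{p_s})$ be a partition of $n$, $n_1>\dots>n_s>0$. $H_\lambda\subset\mathrm{GL}(N)$ is the group of block-diagonal matrices $h=\mathrm{diag}(h^{(i,k)})$, $1\le i\le s$, $1\le k\le p_i$ (lexicographic order), $h^{(i,k)}\in J_r(n_i)$ with entries $h^{(i,k)}_a$ ($0\le a<n_i$). $\tilde H_\lambda,\tilde J_r(p)$ are universal covering groups. $\mu_{i,j}(x)$ is defined by $(x_1T+x_2T^2+\cdots)^i=\sum_{j\ge0}\mu_{i,j}(x)T^j$ ($0$-th power equal to $1$), $W_r(p)=\{(\mu_{i,j}(c)1_r)_{0\le i,j<p}\mid c\in\mathbb C^{p-1},\ c_1\ne0\}\subset\mathrm{GL}(pr)$, $W_r(1)=\{1_r\}$, and $U=\prod_iW_r(n_i)^{p_i}\subset\mathrm{GL}(N)$ (block diagonal); $U$ is the identity component of the Weyl group $N_{\mathrm{GL}(N)}(H_\lambda)/H_\lambda$ realized as a subgroup of $N_{\mathrm{GL}(N)}(H_\lambda)$. Characters. For $\alpha=(\alpha^{(i,k)})\in\mathbb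 C^n$, $\alpha^{(i,k)}=(\alpha^{(i,k)}_0,\dots,\alpha^{(i,k)}_{n_i-1})$, put $\chi(h;\alpha)=\prod_{i,k}\chi_{n_i}(h^{(i,k)};\alpha^{(i,k)})$, $h\in\tilde H_\lambda$, where on $\tilde J_r(p)$ $$\chi_p(h;\alpha)=(\det h_0)^{\alpha_0}\exp\Bigl(\sum_{1\le a<p}\alpha_a\operatorname{Tr}\theta_a(\underline h)\Bigr),\quad \underline h=h_0^{-1}h,$$ and, for $\underline h=1_r+\sum_{1\le a<p}\underline h_aw^a$ (identifying $J_r(p)$ with the units of $\mathrm{Mat}(r)[w]/(w^p)$), $\log\underline h=\sum_{1\le a<p}\theta_a(\underline h)w^a$. Conditions on parameters (assumed for every Radon hypergeometric function, in particular for $\alpha$): (i) $\alpha_0^{(i,k)}\notin\mathbb Z$ for all $i,k$; (ii) $\alpha^{(i,k)}_{n_i-1}\ne0$ if $n_i\ge2$; (iii) $\sum_{i,k}\alpha_0^{(i,k)}=-m$. Radon hypergeometric function. $\iota:H_\lambda\to\mathrm{Mat}(r,N)$ sends $h$ to the row of $r\times r$ blocks $(h^{(i,k)}_0,\dots,h^{(i,k)}_{n_i-1})_{i,k}$; it is injective with Zariski open image. $Z$ is the set of $z=(z^{(i,k)}_a)\in\mathrm{Mat}(m,N)$ of rank $m$, with blocks $z^{(i,k)}_a\in\mathrm{Mat}(m,r)$ ($0\le a<n_i$), such that $\operatorname{rank}z_0^{(i,k)}=r$ for all $(i,k)$. Let $T=\mathrm{Gr}(r,m)=\mathrm{GL}(r)\backslash\{t\in\mathrm{Mat}(r,m):\operatorname{rank}t=r\}$,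 $X_z=\{[t]\in T:\det(tz^{(i,k)}_0)\ne0\ \forall i,k\}$, and $\tau(t)=(\det t')^m\bigwedge du_{i,j}$ where $t=(t',t'')$, $t'\in\mathrm{Mat}(r)$, $u=(t')^{-1}t''$. Write $\chi(tz;\alpha)$ for $\chi(\iota^{-1}(tz);\alpha)$ (multivalued in $t$). Then $$F(z,\alpha;C)=\int_{C(z)}\chi(tz;\alpha)\,\tau(t),$$ where $C(z)$ is a cycle of the homology group $H^{\Phi_z}_{r(m-r)}(X_z;\mathcal L_z)$ of locally finite chains with coefficients in the rank one local system $\mathcal L_z$ on $X_z$ defined by the monodromy of $\chi(tz;\alpha)\tau(t)$ and with supports in the family $\Phi_z$ of closed sets $A\subset X_z$ such that $A\cap\{\operatorname{Re}g_z\ge a\}$ is compact for all $a\in\mathbb R$, $g_z(t)=\sum_{i,k}\sum_{1\le a<n_i}\alpha_a^{(i,k)}\operatorname{Tr}\theta_a(\underline{tz}^{(i,k)})$ being the exponent of the exponential factor of $\chi(tz;\alpha)$. For $g\in U$ one has $zg^{-1}\in Z$ and $X_{zg^{-1}}=X_z$; the same cycle is used for $F(z,\alpha;C)$ and $F(z',\beta;C)$. *)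

(* Defs.v *)
From HB Require Import structures.
From mathcomp Require Import all_boot all_order all_algebra complex.
From mathcomp Require Import generic_quotient.
From mathcomp Require Import all_classical all_reals all_analysis.

Set Implicit Arguments.
Unset Strict Implicit.
Unset Printing Implicit Defensive.

Import Order.TTheory GRing.Theory Num.Theory.
Import numFieldNormedType.Exports.

Local Open Scope classical_set_scope.
Local Open Scope ring_scope.
Local Open Scope complex_scope.
Local Open Scope quotient_scope.

HB.instance Definition _ (R : realType) :=
  PseudoPointedMetric.copy R[i] R[i]^o.
HB.instance Definition _ (R : realType) := NormedModule.copy R[i] R[i]^o.

Definition cexp (R : realType) (z : R[i]) : R[i] :=
  (expR (complex.Re z) * cos (complex.Im z))
    +i* (expR (complex.Re z) * sin (complex.Im z)).

(* The partition (n_1, .., n_1, .., n_s, .., n_s) with n_1 > .. > n_s > 0 and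
   n_i repeated p_i times: s = nparts, n_i = psize i, p_i = mult i.
   Indices start at 0. *)
Record mpartition := MPartition {
  nparts : nat;
  psize : 'I_nparts -> nat;
  mult : 'I_nparts -> nat;
  psize_gt0 : forall i, (0 < psize i)%N;
  mult_gt0 : forall i, (0 < mult i)%N;
  psize_decr : forall i j : 'I_nparts, (i < j)%N -> (psize j < psize i)%N }.

Arguments psize : clear implicits.
Arguments mult : clear implicits.

Definition weight (lam : mpartition) : nat :=
  \sum_(i < nparts lam) mult lam i * psize lam i.

(* [ncols r lam] is N = nr (see [ncolsE]), written as the iterated sum that
   gives the columns their block structure. *)
Notation jdim r p := (\sum_(a < p) r)%N (only parsing).
Notation ncols r lam :=
  (\sum_(i < nparts lam) \sum_(k < mult lam i) \sum_(a < psize lam i) r)%N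
  (only parsing).

Lemma ncolsE (r : nat) (lam : mpartition) :
  ncols r lam = (weight lam * r)%N.
Proof.
rewrite /weight big_distrl /=; apply: eq_bigr => i _.
by rewrite !sum_nat_const !card_ord mulnA.
Qed.

Section Groups.
Variable R : realType.
Local Notation C := R[i].

Section Jordan.
Variables (r p : nat).

Definition J_group : set 'M[C]_(jdim r p) :=
  [set \mxblock_(a < p, b < p)
         (if (a <= b)%N then h (b - a)%N else 0 : 'M[C]_r)
  | h in [set h : nat -> 'M[C]_r | h 0%N \in unitmx]].

Definition ord_sub (a b : 'I_p) : 'I_p :=
  Ordinal (leq_ltn_trans (leq_subr b a) (ltn_ord a)).

Definition toeplitz (y : 'M[C]_(r, jdim r p)) : 'M[C]_(jdim r p) :=
  \mxblock_(a < p, b < p)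
    (if (a <= b)%N then submxrow y (ord_sub b a) else 0).

Definition mu (c : nat -> C) (a b : nat) : C :=
  ((\sum_(1 <= k < p) c k *: 'X^k) ^+ a)`_b.

Definition W_group : set 'M[C]_(jdim r p) :=
  [set \mxblock_(a < p, b < p) ((mu c a b)%:M : 'M[C]_r)
  | c in [set c : nat -> C | (1 < p)%N -> c 1%N != 0]].

Variable p_gt0 : (0 < p)%N.
Let o : 'I_p := Ordinal p_gt0.

Definition jentry (h : 'M[C]_(jdim r p)) (a : 'I_p) : 'M[C]_r :=
  submxblock h o a.

Definition junder (h : 'M[C]_(jdim r p)) : 'M[C]_(jdim r p) :=
  (\mxdiag_(a < p) invmx (jentry h o)) *m h.

(* Under the identification of J_r(p) with the units of Mat(r)[w]/(w^p), w is
   the nilpotent block shift, so for u = 1 + (terms in w) the series of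
   log u stops before the p-th power of u - 1. *)
Definition jlog (u : 'M[C]_(jdim r p)) : 'M[C]_(jdim r p) :=
  \sum_(1 <= j < p) ((-1) ^+ j.-1 / j%:R) *: (u - 1%:M) ^+ j.

Definition theta (a : 'I_p) (u : 'M[C]_(jdim r p)) : 'M[C]_r :=
  jentry (jlog u) a.

Definition jexponent (h : 'M[C]_(jdim r p)) (al : 'I_p -> C) : C :=
  \sum_(a < p | (0 < a)%N) al a * \tr (theta a (junder h)).

(* A point of the universal cover of J_r(p) is a pair (h, l) with h in J_r(p)
   and exp l = det h_0: SL(r) and Mat(r)^(p-1) are simply connected, so these
   pairs form a simply connected covering group.  On it the multivalued
   (det h_0)^(alpha_0) is the function exp (alpha_0 l). *)
Definition chi_J (h : 'M[C]_(jdim r p)) (l : C) (al : 'I_p -> C) : C :=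
  cexp (al o * l) * cexp (jexponent h al).

End Jordan.

Section Partition.
Variables (r : nat) (lam : mpartition).

Definition ord_z (i : 'I_(nparts lam)) : 'I_(psize lam i) :=
  Ordinal (psize_gt0 i).

Definition col_block (q : nat) (z : 'M[C]_(q, ncols r lam))
    (i : 'I_(nparts lam)) (k : 'I_(mult lam i)) (a : 'I_(psize lam i)) :
    'M[C]_(q, r) :=
  submxrow (submxrow (submxrow z i) k) a.

Definition diag_block (h : 'M[C]_(ncols r lam))
    (i : 'I_(nparts lam)) (k : 'I_(mult lam i)) :
    'M[C]_(jdim r (psize lam i)) :=
  submxblock (submxblock h i i) k k.

Definition H_group : set 'M[C]_(ncols r lam) :=
  [set \mxdiag_(i < nparts lam) \mxdiag_(k < mult lam i) h i k
  | h in [set h : forall i, 'I_(mult lam i) -> 'M[C]_(jdim r (psize lam i))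
         | forall i k, J_group (h i k)]].

Definition U_group : set 'M[C]_(ncols r lam) :=
  [set \mxdiag_(i < nparts lam) \mxdiag_(k < mult lam i) w i k
  | w in [set w : forall i, 'I_(mult lam i) -> 'M[C]_(jdim r (psize lam i))
         | forall i k, W_group (w i k)]].

Definition iota_H (h : 'M[C]_(ncols r lam)) : 'M[C]_(r, ncols r lam) :=
  \mxrow_(i < nparts lam) \mxrow_(k < mult lam i) \mxrow_(a < psize lam i)
    jentry (psize_gt0 i) (diag_block h k) a.

Definition iota_inv (y : 'M[C]_(r, ncols r lam)) : 'M[C]_(ncols r lam) :=
  \mxdiag_(i < nparts lam) \mxdiag_(k < mult lam i)
    toeplitz (submxrow (submxrow y i) k).

Definition logs := forall i : 'I_(nparts lam), 'I_(mult lam i) -> C.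

Definition param :=
  forall i : 'I_(nparts lam), 'I_(mult lam i) -> 'I_(psize lam i) -> C.

Definition H_cover : set ('M[C]_(ncols r lam) * logs) :=
  [set hl | H_group hl.1 /\
     forall i k, cexp (hl.2 i k) =
       \det (jentry (psize_gt0 i) (diag_block hl.1 k) (ord_z i))].

Definition chi (hl : 'M[C]_(ncols r lam) * logs) (al : param) : C :=
  \prod_(i < nparts lam) \prod_(k < mult lam i)
    chi_J (psize_gt0 i) (diag_block hl.1 k) (hl.2 i k) (al i k).

Definition exponent (h : 'M[C]_(ncols r lam)) (al : param) : C :=
  \sum_(i < nparts lam) \sum_(k < mult lam i)
    jexponent (psize_gt0 i) (diag_block h k) (al i k).

Definition param_cond (m : nat) (al : param) : Prop :=
  [/\ forall i k (q : int), al i k (ord_z i) <> q%:~R,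
      forall i k (a : 'I_(psize lam i)),
        (2 <= psize lam i)%N -> a = (psize lam i).-1 :> nat -> al i k a != 0 &
      \sum_(i < nparts lam) \sum_(k < mult lam i) al i k (ord_z i) = - m%:R].

Definition normal_param (al : param) : param := fun i k a =>
  if a == 0%N :> nat then al i k (ord_z i)
  else if a == (psize lam i).-1 :> nat then 1 else 0.

End Partition.
End Groups.

Arguments normal_param {R lam} al i k a.

Section IotaTheory.
Variables (R : realType) (r : nat) (lam : mpartition).

Lemma diag_blockE
    (B : forall i, 'I_(mult lam i) -> 'M[R[i]]_(jdim r (psize lam i))) i k :
  diag_block (\mxdiag_(i < nparts lam) \mxdiag_(k < mult lam i) B i k) k = B i k.
Proof. by rewrite /diag_block !submxblock_diag. Qed.

Lemma iota_invK : cancel (@iota_inv R r lam) (@iota_H R r lam).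
Proof.
move=> y; rewrite /iota_H /iota_inv -[RHS]submxrowK; apply: eq_mxrow => i.
rewrite -[RHS]submxrowK; apply: eq_mxrow => k.
rewrite -[RHS]submxrowK; apply: eq_mxrow => a.
rewrite diag_blockE /jentry /toeplitz mxblockK /=.
by congr submxrow; apply/val_inj; rewrite /= subn0.
Qed.

Lemma iota_HK : {in @H_group R r lam, cancel (@iota_H R r lam) (@iota_inv R r lam)}.
Proof.
move=> g /set_mem [h hJ <-]; rewrite /iota_inv.
apply: eq_mxdiag => i; apply: eq_mxdiag => k.
rewrite /iota_H !mxrowK; have [f _ hE] := hJ i k.
rewrite -[RHS]hE /toeplitz; apply: eq_mxblock => a b; case: ifP => // _.
by rewrite !mxrowK diag_blockE /jentry -hE mxblockK /= subn0.
Qed.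

End IotaTheory.

Section Grassmannian.
Variables (R : realType) (r m : nat).
Local Notation C := R[i].

Definition stiefel_set : set 'M[C]_(r, m) := [set t | \rank t = r].

(* Frames t, with the topology induced from Mat(r, m). *)
Definition stiefel : Type := set_type stiefel_set.
HB.instance Definition _ := Topological.copy stiefel (set_type stiefel_set).
Definition frame_mx (t : stiefel) : 'M[C]_(r, m) := \val t.

Definition gl_equiv (t t' : stiefel) : bool :=
  `[< exists2 h : 'M[C]_r, h \in unitmx & frame_mx t' = h *m frame_mx t >].

Lemma gl_equiv_refl : reflexive gl_equiv.
Proof. by move=> t; apply/asboolP; exists 1%:M; rewrite ?unitmx1 ?mul1mx. Qed.

Lemma gl_equiv_sym : symmetric gl_equiv.
Proof.
by move=> t t'; apply/asboolP/asboolP => -[h hU E]; exists (invmx h);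
  rewrite ?unitmx_inv// E mulKmx.
Qed.

Lemma gl_equiv_trans : transitive gl_equiv.
Proof.
move=> t2 t1 t3 /asboolP[h hU E] /asboolP[h' hU' E']; apply/asboolP.
by exists (h' *m h); [rewrite unitmx_mul hU hU'|rewrite E' E mulmxA].
Qed.

Canonical gl_equiv_rel :=
  EquivRel gl_equiv gl_equiv_refl gl_equiv_sym gl_equiv_trans.

Definition Gr := quotient_topology {eq_quot gl_equiv}.
HB.instance Definition _ := Topological.copy Gr (quotient_topology {eq_quot gl_equiv}).
HB.instance Definition _ := Quotient.copy Gr (quotient_topology {eq_quot gl_equiv}).

Definition gr_class (t : stiefel) : Gr := \pi_Gr t.

(* The form tau at t applied to tangent vectors v_1, .., v_d, d = r(m - r), on
   the set det t' != 0: there du = t'^-1 (dt'' - dt' u), and the wedge of the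
   du_ij, in lexicographic order, is a determinant.  Only used for r <= m, when
   [conform_mx] is the identification of Mat(r, m) with Mat(r, r + (m - r)). *)
Definition split_cols (t : 'M[C]_(r, m)) : 'M[C]_(r, r + (m - r)) :=
  conform_mx 0 t.

Definition du (t v : 'M[C]_(r, m)) : 'M[C]_(r, m - r) :=
  let t1 := lsubmx (split_cols t) in let t2 := rsubmx (split_cols t) in
  let v1 := lsubmx (split_cols v) in let v2 := rsubmx (split_cols v) in
  invmx t1 *m (v2 - v1 *m (invmx t1 *m t2)).

Definition tau_chart (t : 'M[C]_(r, m)) (v : 'I_(r * (m - r)) -> 'M[C]_(r, m)) :
    C :=
  \det (lsubmx (split_cols t)) ^+ m *
  \det (\matrix_(k < r * (m - r)) mxvec (du t (v k))).

(* For fixed v, [tau_chart t v] is a polynomial in t where det t' != 0; tau is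
   its continuous extension to all frames. *)
Definition tau (t : 'M[C]_(r, m)) (v : 'I_(r * (m - r)) -> 'M[C]_(r, m)) : C :=
  lim (tau_chart x v @[x --> within
         [set x | \det (lsubmx (split_cols x)) != 0] (nbhs t)]).

End Grassmannian.

Section Simplices.
Variable R : realType.

(* The standard simplex of dimension n - 1, in barycentric coordinates. *)
Definition splx (n : nat) : set 'rV[R]_n :=
  [set s | (forall i, 0 <= s 0 i) /\ \sum_(i < n) s 0 i = 1].

Definition face (n : nat) (q : 'I_n.+1) (x : 'rV[R]_n) : 'rV[R]_n.+1 :=
  \row_(j < n.+1) (if unlift q j is Some k then x 0 k else 0).

Definition bary (n : nat) (y : 'rV[R]_n) : 'rV[R]_n.+1 :=
  row_mx (1 - \sum_(i < n) y 0 i)%:M y : 'rV[R]_(1 + n).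

(* Iterated integral over { y | 0 <= y_i, y_1 + .. + y_n <= b }. *)
Fixpoint corner_integral (n : nat) (b : R) : ('rV[R]_n -> R) -> R :=
  match n return ('rV[R]_n -> R) -> R with
  | 0 => fun f => f 0
  | n'.+1 => fun f =>
      \int[lebesgue_measure]_(x in `[0, b])
        corner_integral (b - x) (fun y => f (row_mx x%:M y : 'rV[R]_(1 + n')))
  end.

Definition splx_integral (n : nat) (f : 'rV[R]_n -> R[i]) : R[i] :=
  corner_integral 1 (fun y => complex.Re (f y))
    +i* corner_integral 1 (fun y => complex.Im (f y)).

Definition C1_near (n : nat) (A : set 'rV[R]_n) (f : 'rV[R]_n -> R) : Prop :=
  exists2 V : set 'rV[R]_n, open V /\ A `<=` V &
    forall x (k : 'I_n), V x ->
      derivable f x (delta_mx 0 k) /\ {for x, continuous ('D_(delta_mx 0 k) f)}.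

Definition pderiv_mx (n r m : nat) (t : 'rV[R]_n -> 'M[R[i]]_(r, m)) (k : 'I_n)
    (y : 'rV[R]_n) : 'M[R[i]]_(r, m) :=
  \matrix_(i < r, j < m)
    ('D_(delta_mx 0 k) (fun x => complex.Re (t x i j)) y
      +i* 'D_(delta_mx 0 k) (fun x => complex.Im (t x i j)) y).

End Simplices.

Section RadonHypergeometric.
Variables (R : realType) (r m : nat) (lam : mpartition).
Local Notation C := R[i].
Local Notation d := (r * (m - r))%N.

Definition Zset : set 'M[C]_(m, ncols r lam) :=
  [set z | \rank z = m /\
     forall i (k : 'I_(mult lam i)), \rank (col_block z k (ord_z i)) = r].

Definition in_X (z : 'M[C]_(m, ncols r lam)) (t : stiefel R r m) : Prop :=
  forall i (k : 'I_(mult lam i)),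
    \det (frame_mx t *m col_block z k (ord_z i)) != 0.

Definition Xset (z : 'M[C]_(m, ncols r lam)) : set (Gr R r m) :=
  [set gr_class t | t in in_X z].

Definition gfun (z : 'M[C]_(m, ncols r lam)) (al : param R lam)
    (t : stiefel R r m) : C :=
  exponent (iota_inv (frame_mx t *m z)) al.

Definition Phi (z : 'M[C]_(m, ncols r lam)) (al : param R lam) :
    set (set (Gr R r m)) :=
  [set A | [/\ A `<=` Xset z,
      exists2 F, closed F & A = F `&` Xset z &
      forall a : R, compact (A `&`
        [set gr_class t | t in [set t | in_X z t /\ a <= complex.Re (gfun z al t)]])]].

(* A countable formal sum of C^1 singular simplices of dimension d in Gr(r, m)
   with coefficients in the local system.  The j-th simplex is the class of the
   frames [sframe j] (every simplex lifts to frames), and its coefficient is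
   [scoef j] times the branch of chi(tz; alpha) along it given by the continuous
   logarithms [slogs j] of the determinants of t z_0^(i,k). *)
Record chain := Chain {
  sframe : nat -> 'rV[R]_d.+1 -> stiefel R r m;
  slogs : nat -> 'rV[R]_d.+1 -> logs R lam;
  scoef : nat -> C }.

Arguments slogs c j s i k : clear implicits.

Definition active (c : chain) : set nat := [set j | scoef c j != 0].

Definition simage (c : chain) (j : nat) : set (Gr R r m) :=
  [set gr_class (sframe c j s) | s in @splx R d.+1].

Definition chi_branch (z : 'M[C]_(m, ncols r lam)) (al : param R lam)
    (c : chain) (j : nat) (s : 'rV[R]_d.+1) : C :=
  chi (iota_inv (frame_mx (sframe c j s) *m z), slogs c j s) al.

Definition is_chain (z : 'M[C]_(m, ncols r lam)) (al : param R lam)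
    (c : chain) : Prop :=
  [/\ forall j, active c j ->
        [/\ forall u v,
              C1_near (@splx R d.+1)
                (fun s => complex.Re (frame_mx (sframe c j s) u v)) /\
              C1_near (@splx R d.+1)
                (fun s => complex.Im (frame_mx (sframe c j s) u v)),
            forall s, splx s ->
              in_X z (sframe c j s) /\
              H_cover (iota_inv (frame_mx (sframe c j s) *m z), slogs c j s) &
            forall i k, {within @splx R d.+1, continuous (fun s => slogs c j s i k)}],
      forall x, Xset z x -> exists2 V, nbhs x V &
        finite_set [set j | active c j /\ simage c j `&` V !=set0] &
      exists2 A, Phi z al A & forall j, active c j -> simage c j `<=` A].

(* The form chi(tz; alpha) tau(t) depends only on the class of t, because
   chi(htz; alpha) = (det h)^(-m) chi(tz; alpha) and tau(ht) = (det h)^m tau(t).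
   Coefficients on simplices with different frames are therefore compared after
   transport to a common frame t0: if t = h t0, the value at t is multiplied by
   (det h)^m. *)
Definition transport (t t0 : 'M[C]_(r, m)) : C := \det (t *m pinvmx t0) ^+ m.

Definition is_cycle (z : 'M[C]_(m, ncols r lam)) (al : param R lam)
    (c : chain) : Prop :=
  is_chain z al c /\
  forall (rho : 'rV[R]_d -> Gr R r m) (x : 'rV[R]_d), splx x ->
    \sum_(jq \in [set jq : nat * 'I_d.+1 | active c jq.1 /\
        forall y, splx y -> gr_class (sframe c jq.1 (face jq.2 y)) = rho y])
      (-1) ^+ jq.2 * scoef c jq.1 *
      (transport (frame_mx (sframe c jq.1 (face jq.2 x))) (frame_mx (repr (rho x))) *
       chi_branch z al c jq.1 (face jq.2 x)) = 0.

Definition simplex_term (z : 'M[C]_(m, ncols r lam)) (al : param R lam)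
    (c : chain) (j : nat) : C :=
  scoef c j * splx_integral (fun y : 'rV[R]_d =>
    chi_branch z al c j (bary y) *
    tau (frame_mx (sframe c j (bary y)))
        (fun k => pderiv_mx (fun y => frame_mx (sframe c j (bary y))) k y)).

Definition RHF_cvg (z : 'M[C]_(m, ncols r lam)) (al : param R lam) (c : chain) :
    Prop :=
  cvgn (series (fun j => `|simplex_term z al c j|)).

Definition RHF (z : 'M[C]_(m, ncols r lam)) (al : param R lam) (c : chain) : C :=
  limn (series (simplex_term z al c)).

(* F(z, alpha; C) = F(zg^-1, beta; C) for all z and C, with one g in U.  That
   the two sides have the same cycles and converge together is included. *)
Definition transforms_to (al be : param R lam) : Prop :=
  exists2 g : 'M[C]_(ncols r lam), U_group g &
    forall z, Zset z ->
      [/\ Zset (z *m invmx g), Xset (z *m invmx g) = Xset z &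
        forall c, (is_cycle z al c <-> is_cycle (z *m invmx g) be c) /\
          (is_cycle z al c ->
             (RHF_cvg z al c <-> RHF_cvg (z *m invmx g) be c) /\
             RHF z al c = RHF (z *m invmx g) be c)].

End RadonHypergeometric.

(* Main.v *)
(* Identify the row (y_0, .., y_(p-1)) of r x r blocks with y(w) in
   Mat(r)[w]/(w^p).  Right multiplication by K = (mu_(a,b)(c) 1_r) is the
   substitution w -> phi(w) = c_1 w + c_2 w^2 + .., an algebra morphism that
   fixes y_0, so it commutes with the logarithm and gives
   theta_b(yK) = sum_a mu_(a,b)(c) theta_a(y).  Hence chi(yK; alpha) =
   chi(y; beta) for all y as soon as alpha_0 = beta_0 and
   sum_b mu_(a,b)(c) alpha_b = beta_a for 1 <= a < p.  This system is solved
   by descending on a: the equation for a = p-1 reads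
   c_1^(p-1) alpha_(p-1) = beta_(p-1), and the one for a = p-1-k is affine in
   c_(k+1) with leading coefficient a c_1^(a-1) alpha_(p-1) <> 0.  With
   g = diag(K^(i,k)), the two integrals then have the same integrand. *)
Require Import Defs.
From HB Require Import structures.
From mathcomp Require Import all_boot all_order all_algebra complex.
From mathcomp Require Import all_classical all_reals all_analysis.
From mathcomp Require Import ring zify.

Set Implicit Arguments.
Unset Strict Implicit.
Unset Printing Implicit Defensive.

Import Order.TTheory GRing.Theory Num.Theory.
Import numFieldNormedType.Exports.

Local Open Scope classical_set_scope.
Local Open Scope ring_scope.
Local Open Scope complex_scope.

(** * Powers of phi and the triangular system for its coefficients *)

Lemma exprD_mod2 (A : comNzRingType) (x y : A) (n : nat) :
  exists q, (x + y) ^+ n = x ^+ n + n%:R * x ^+ n.-1 * y + y ^+ 2 * q.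
Proof.
elim: n => [|n [q IH]]; first by exists 0; rewrite !expr0 !mul0r mulr0 !addr0.
exists (n%:R * x ^+ n.-1 + (x + y) * q); rewrite exprS IH /=.
case: n {IH} => [|n] /=; first by rewrite !expr0 expr1; ring.
by rewrite !exprS -[n.+2]addn1 natrD; ring.
Qed.

Section Mu.
Variable R : realType.
Local Notation C := R[i].
Implicit Types (p : nat) (c : nat -> C).

(** Writing phi = X f turns phi^a into X^a f^a, which exposes the triangular shape and the
    diagonal. *)
Lemma mu_shift p c a b :
  mu p c a b = if (b < a)%N then 0
               else ((\poly_(k < p.-1) c k.+1) ^+ a)`_(b - a).
Proof.
rewrite /mu; have -> : \sum_(1 <= k < p) c k *: 'X^k =
    'X * \poly_(k < p.-1) c k.+1 :> {poly C}.
  rewrite big_add1 big_mkord poly_def big_distrr /=.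
  by apply: eq_bigr => k _; rewrite -scalerAr exprS.
by rewrite exprMn mulrC coefMXn.
Qed.

Lemma mu_lt p c a b : (b < a)%N -> mu p c a b = 0.
Proof. by move=> ba; rewrite mu_shift ba. Qed.

Lemma mu0 p c b : mu p c 0 b = (b == 0%N)%:R.
Proof. by rewrite /mu expr0 coef1. Qed.

Lemma mu_diag p c a : (a < p)%N -> mu p c a a = c 1%N ^+ a.
Proof.
case: a => [|a] ap; first by rewrite mu0 expr0.
rewrite mu_shift ltnn subnn -horner_coef0 horner_exp horner_coef0 coef_poly.
by case: p ap => [|[|p]].
Qed.

Lemma muD p c a d b :
  mu p c (a + d) b = \sum_(j < b.+1) mu p c a j * mu p c d (b - j).
Proof. by rewrite /mu exprD coefM. Qed.

Definition bump_coef c k (x : C) : nat -> C :=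
  fun j => if j == k.+1 then c j + x else c j.

(** Raising c_(k+1) by x adds x X^k to f = phi / X, hence a f^(a-1) x X^k to f^a modulo X^(2k). As k
    > 0, degree k of f^a is the first that can change, and there f^(a-1) contributes f(0)^(a-1). *)
Lemma mu_bump p c k x a : (0 < k)%N -> (k.+1 < p)%N ->
  (forall b, (b < a + k)%N -> mu p (bump_coef c k x) a b = mu p c a b) /\
  mu p (bump_coef c k x) a (a + k) =
    mu p c a (a + k) + a%:R * c 1%N ^+ a.-1 * x.
Proof.
move=> k0 kp; have ? : (k < p.-1)%N by lia.
have bumpE : \poly_(j < p.-1) bump_coef c k x j.+1 =
    \poly_(j < p.-1) c j.+1 + x *: 'X^k.
  apply/polyP => j; rewrite coefD coefZ coefXn !coef_poly /bump_coef eqSS.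
  by have [->|] := eqVneq j k; case: ifP; rewrite ?mulr1 ?mulr0 ?addr0//; lia.
have -> : mu p (bump_coef c k x) a = fun b => if (b < a)%N then 0 else
    ((\poly_(j < p.-1) c j.+1 + x *: 'X^k) ^+ a)`_(b - a).
  by apply/funext => b; rewrite mu_shift bumpE.
have [q ->] := exprD_mod2 (\poly_(k < p.-1) c k.+1) (x *: 'X^k) a.
set f := \poly_(_ < _) _.
have coefq j : (j <= k)%N ->
    (f ^+ a + a%:R * f ^+ a.-1 * (x *: 'X^k) + (x *: 'X^k) ^+ 2 * q)`_j =
    (f ^+ a)`_j + (if (j < k)%N then 0 else a%:R * c 1%N ^+ a.-1 * x).
  move=> jk; rewrite !coefD exprZn -exprM -scalerAl -scalerAr !coefZ.
  rewrite [_ * q]mulrC !coefMXn.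
  have -> : (j < k * 2)%N by lia.
  case: ltnP => kj; first by rewrite !mulr0 !addr0.
  have -> : j = k by lia.
  rewrite subnn mulr0 addr0 [_%:R * f ^+ _]mulr_natl coefMn.
  rewrite -horner_coef0 horner_exp horner_coef0 coef_poly.
  have -> : (0 < p.-1)%N by lia.
  by rewrite mulr_natl mulrC.
split=> [b bk|]; last first.
  by rewrite ltnNge leq_addr /= addKn coefq// ltnn mu_shift ltnNge leq_addr addKn.
case: ltnP => ab; first by rewrite mu_lt.
have bk' : (b - a < k)%N by lia.
by rewrite coefq ?(ltnW bk')// bk' addr0 mu_shift ltnNge ab.
Qed.

Lemma mu_solve p (al be : nat -> C) : (1 < p)%N ->
  al p.-1 != 0 -> be p.-1 != 0 ->
  exists2 c, c 1%N != 0 &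
    forall a, (0 < a < p)%N -> \sum_(b < p) mu p c a b * al b = be a.
Proof.
case: p => [|q] //= q0 alq beq; rewrite ltnS in q0.
(* After stage k the equations for a >= q - k hold, where q = p - 1 is the last index. *)
suff solve k : (k < q)%N -> exists2 c, c 1%N != 0 & forall a,
    (0 < a)%N -> (q - k <= a <= q)%N -> \sum_(b < q.+1) mu q.+1 c a b * al b = be a.
  have [|c c1 cE] := solve q.-1; first by lia.
  by exists c => // a /andP[a0 aq]; apply: cE => //; lia.
elim: k => [_|k IH kq].
  (* Stage 0 is the single equation c_1^q al_q = be_q, which involves c_1 alone. *)
  exists (fun=> q.-root (be q / al q)).
    by rewrite rootC_eq0// mulf_neq0// invr_neq0.
  move=> a a0; rewrite subn0 -eqn_leq => /eqP <-.
  rewrite big_ord_recr /= big1 ?add0r => [|b _]; last by rewrite mu_lt ?mul0r.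
  by rewrite mu_diag// rootCK// divfK.
have [|c c1 cE] := IH; first exact: ltnW.
pose a0 := (q - k.+1)%N; have a0_gt0 : (0 < a0)%N by rewrite /a0; lia.
have a0q : (a0 + k.+1 = q)%N by rewrite /a0; lia.
pose S0 := \sum_(b < q.+1) mu q.+1 c a0 b * al b.
(* The increment of c_(k+2) that solves the equation at a0; only its last column q feels it. *)
pose x := (be a0 - S0) / (al q * (a0%:R * c 1%N ^+ a0.-1)).
exists (bump_coef c k.+1 x); first by rewrite /bump_coef /=.
move=> a a_gt0 aq; have [||muE muE'] := @mu_bump q.+1 c k.+1 x a => //.
(* For a > a0 the first column that could change, a + k + 1, lies beyond q, so the solved equations
   survive. *)
have [aE|aNa0] := eqVneq a a0; last first.
  rewrite -(cE a)//; last by lia.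
  by apply: eq_bigr => b _; rewrite muE//; have := ltn_ord b; lia.
rewrite aE a0q in muE muE' *; rewrite big_ord_recr /= muE' mulrDl addrA.
rewrite (eq_bigr (fun b : 'I_q => mu q.+1 c a0 b * al b)); last first.
  by move=> b _; rewrite muE//; have := ltn_ord b; lia.
have -> : \sum_(b < q) mu q.+1 c a0 b * al b + mu q.+1 c a0 q * al q = S0.
  by rewrite /S0 big_ord_recr.
rewrite /x; set y := a0%:R * _; have y0 : y != 0.
  by rewrite mulf_neq0 ?pnatr_eq0 -?lt0n// expf_neq0.
by field; rewrite y0.
Qed.

End Mu.

(** * The substitution w -> phi(w) on one Jordan block *)

Section Substitution.
Variables (R : realType) (r p : nat) (c : nat -> R[i]).
Local Notation C := R[i].
Implicit Type y : 'M[C]_(r, jdim r p).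

Definition mu_mx : 'M[C]_(jdim r p) :=
  \mxblock_(a < p, b < p) ((mu p c a b)%:M : 'M[C]_r).

(** The scalar matrix [M] is upper triangular with diagonal c_1^a, and its inverse gives the scalar
    blocks of the inverse. At a = 0 the diagonal entry is 1, which covers p = 1. *)
Lemma mu_mx_unit : ((1 < p)%N -> c 1%N != 0) -> mu_mx \in unitmx.
Proof.
move=> c1; pose M : 'M[C]_p := \matrix_(a, b) mu p c a b.
have MU : M \in unitmx.
  rewrite unitmxE -det_tr det_trig; last first.
    by apply/is_trig_mxP => a b ab; rewrite !mxE mu_lt.
  rewrite unitfE; apply/prodf_neq0 => a _.
  rewrite !mxE mu_diag// expf_eq0 negb_and; case: a => [[|a] ap] //=.
  by apply: c1; apply: leq_ltn_trans ap.
pose W := \mxblock_(a < p, b < p) ((invmx M a b)%:M : 'M[C]_r).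
suff /mulmx1_unit[] : mu_mx *m W = 1%:M by [].
rewrite mul_mxblock -mxdiagZ; apply: eq_mxblock => a b.
transitivity (((M *m invmx M) a b)%:M : 'M[C]_r).
  rewrite mxE raddf_sum; apply: eq_bigr => d _.
  by rewrite mxE -scalar_mxM.
rewrite mulmxV// mxE; case: eqP => _; first by rewrite conform_mx_id.
by rewrite mulr0n raddf0.
Qed.

Lemma submxrow_mu_mx q (y : 'M[C]_(q, jdim r p)) (b : 'I_p) :
  submxrow (y *m mu_mx) b = \sum_(a < p) mu p c a b *: submxrow y a.
Proof.
rewrite -{1}[y]submxrowK mul_mxrow_mxblock mxrowK.
by apply: eq_bigr => a _; rewrite mul_mx_scalar.
Qed.

Lemma submxrow_mu_mx0 q (y : 'M[C]_(q, jdim r p)) (b : 'I_p) : b = 0%N :> nat ->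
  submxrow (y *m mu_mx) b = submxrow y b.
Proof.
move=> b0; rewrite submxrow_mu_mx (bigD1 b)//= b0 mu0 scale1r big1 ?addr0//.
move=> a; rewrite -(inj_eq val_inj) /= b0 -lt0n => a0.
by rewrite mu_lt ?scale0r.
Qed.

(* Both sides have a-th block row phi^a y(phi), phi = c_1 w + c_2 w^2 + ... *)
Lemma toeplitz_mu_mx y :
  toeplitz y *m mu_mx = mu_mx *m toeplitz (y *m mu_mx).
Proof.
rewrite !mul_mxblock; apply: eq_mxblock => a b.
transitivity (\sum_(d < p) mu p c (a + d) b *: submxrow y d).
  (* The blocks of y extended by zero to [nat], so that sums can be shifted by a. *)
  pose Y n : 'M[C]_r := oapp (submxrow y) 0 (insub n).
  have YE (d : 'I_p) : submxrow y d = Y d by rewrite /Y valK.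
  rewrite (eq_bigr (fun d : 'I_p => if (a <= d)%N then
      mu p c d b *: Y (d - a)%N else 0)); last first.
    by move=> d _; case: ifP => _; rewrite mul_mx_scalar ?scaler0// YE.
  under [RHS]eq_bigr do rewrite YE.
  rewrite -big_mkcond /= -(big_geq_mkord a p xpredT
    (fun d => mu p c d b *: Y (d - a)%N)).
  rewrite -{1}[nat_of_ord a]add0n big_addn big_mkord.
  rewrite (big_ord_widen _ (fun d => mu p c (d + a)%N b *: Y (d + a - a)%N)
    (leq_subr a p)) big_mkcond; apply: eq_bigr => d _.
  (* Terms with a + d >= p vanish, because b < p <= a + d. *)
  rewrite addnK addnC; case: ltnP => // pad.
  by rewrite mu_lt ?scale0r//; have := ltn_ord b; lia.
rewrite (eq_bigr (fun d : 'I_p => \sum_(j < b.+1)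
    mu p c a j *: (mu p c d (b - j) *: submxrow y d))); last first.
  by move=> d _; rewrite muD scaler_suml; apply: eq_bigr => j _; rewrite scalerA.
rewrite exchange_big (big_ord_widen _ (fun j => \sum_(d < p)
    mu p c a j *: (mu p c d (b - j) *: submxrow y d)) (ltn_ord b)) big_mkcond.
apply: eq_bigr => j _; rewrite ltnS; case: ifP => _; last by rewrite mulmx0.
by rewrite submxrow_mu_mx mul_scalar_mx scaler_sumr.
Qed.

Variable p_gt0 : (0 < p)%N.
Let o : 'I_p := Ordinal p_gt0.

Lemma jentry_toeplitz y a : jentry p_gt0 (toeplitz y) a = submxrow y a.
Proof.
by rewrite /jentry mxblockK /=; congr submxrow; apply/val_inj; rewrite /= subn0.
Qed.

Lemma jentry_mul_mu_mx (h : 'M[C]_(jdim r p)) b :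
  jentry p_gt0 (h *m mu_mx) b = \sum_(a < p) mu p c a b *: jentry p_gt0 h a.
Proof.
rewrite /jentry -{1}[h]submxblockK mul_mxblock mxblockK.
by apply: eq_bigr => a _; rewrite mul_mx_scalar.
Qed.

(** Since phi^0 = 1, block row 0 of [mu_mx] is that of the identity, and [jentry] reads only block
    row 0. *)
Lemma jentry_mu_mx_mul (h : 'M[C]_(jdim r p)) b :
  jentry p_gt0 (mu_mx *m h) b = jentry p_gt0 h b.
Proof.
rewrite /jentry -{1}[h]submxblockK mul_mxblock mxblockK.
rewrite (bigD1 o)//= mu0 mul1mx big1 ?addr0// => a.
rewrite -(inj_eq val_inj) /= mu0 => /negPf ->.
by rewrite raddf0 mul0mx.
Qed.

(** [mu_mx] has scalar blocks and the substitution fixes h_0, so division by h_0 passes through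
    [toeplitz_mu_mx]. *)
Lemma junder_mu_mx y :
  junder p_gt0 (toeplitz y) *m mu_mx =
  mu_mx *m junder p_gt0 (toeplitz (y *m mu_mx)).
Proof.
rewrite /junder !jentry_toeplitz submxrow_mu_mx0// -mulmxA toeplitz_mu_mx !mulmxA.
congr (_ *m _); rewrite mul_mxdiag_mxblock mul_mxblock_mxdiag.
by apply: eq_mxblock => a b; rewrite mul_mx_scalar mul_scalar_mx.
Qed.

(** [jlog] is a fixed polynomial in its argument, so any intertwiner of the arguments intertwines
    the values. *)
Lemma jlog_intertwine (A B K : 'M[C]_(jdim r p)) :
  A *m K = K *m B -> jlog A *m K = K *m jlog B.
Proof.
move=> AK; rewrite /jlog mulmx_suml mulmx_sumr; apply: eq_bigr => j _.
rewrite -scalemxAl -scalemxAr; congr (_ *: _).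
have AK1 : (A - 1%:M) *m K = K *m (B - 1%:M).
  by rewrite mulmxBl mulmxBr AK mul1mx mulmx1.
elim: j => [|j IH]; first by rewrite !expr0 mul1mx mulmx1.
have expS X : X ^+ j.+1 = X *m X ^+ j :> 'M[C]_(jdim r p) by rewrite exprS.
by rewrite !expS -mulmxA IH mulmxA AK1 -mulmxA.
Qed.

Lemma theta_mu_mx y b :
  theta p_gt0 b (junder p_gt0 (toeplitz (y *m mu_mx))) =
  \sum_(a < p) mu p c a b *: theta p_gt0 a (junder p_gt0 (toeplitz y)).
Proof.
rewrite /theta -jentry_mul_mu_mx (jlog_intertwine (junder_mu_mx y)).
by rewrite jentry_mu_mx_mul.
Qed.

(** By transposition the matrix mu moves from the theta_a to the parameters. Leaving out index 0 on
    both sides is consistent, as mu_(0,b) = 0 for b > 0 and mu_(a,0) = 0 for a > 0. *)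
Lemma jexponent_mu_mx y (al be : 'I_p -> C) :
  (forall a : 'I_p, (0 < a)%N -> \sum_(b < p) mu p c a b * al b = be a) ->
  jexponent p_gt0 (toeplitz (y *m mu_mx)) al = jexponent p_gt0 (toeplitz y) be.
Proof.
move=> albe; rewrite /jexponent.
pose t a := theta p_gt0 a (junder p_gt0 (toeplitz y)).
transitivity (\sum_(b < p | (0 < b)%N) \sum_(a < p)
    al b * (mu p c a b * \tr (t a))).
  apply: eq_bigr => b _; rewrite (theta_mu_mx y b) raddf_sum mulr_sumr.
  by apply: eq_bigr => a _; rewrite /= mxtraceZ.
rewrite exchange_big [RHS]big_mkcond; apply: eq_bigr => a _.
have [a0|a0] := posnP a.
  by rewrite big1// => b b0; rewrite a0 mu0 eqn0Ngt b0 mul0r mulr0.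
rewrite -albe// mulr_suml big_mkcond; apply: eq_bigr => b _.
by case: posnP => [b0|_]; [rewrite mu_lt ?b0// !mul0r|rewrite mulrCA mulrA].
Qed.

End Substitution.

(** * Block-diagonal matrices, the inverse of iota and the cover of H *)

Lemma submxrow_mul_mxdiag (S : nzRingType) (s q : nat) (p_ : 'I_s -> nat)
    (y : 'M[S]_(q, \sum_i p_ i)) (D : forall i, 'M[S]_(p_ i)) i :
  submxrow (y *m \mxdiag_i D i) i = submxrow y i *m D i.
Proof. by rewrite -{1}[y]submxrowK mul_mxrow_mxdiag mxrowK. Qed.

Lemma mxdiag_unitmx (S : comUnitRingType) (s : nat) (p_ : 'I_s -> nat)
    (D : forall i, 'M[S]_(p_ i)) :
  (forall i, D i \in unitmx) -> \mxdiag_i D i \in unitmx.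
Proof.
move=> DU; suff /mulmx1_unit[] : \mxdiag_i D i *m \mxdiag_i invmx (D i) = 1%:M by [].
rewrite {2}/mxdiag mul_mxdiag_mxblock -mxdiagZ; apply: eq_mxblock => i j.
case: eqVneq => [ij|_]; last by rewrite mulmx0.
by case: _ / ij; rewrite !conform_mx_id mulmxV.
Qed.

Definition jrow (R : realType) (r : nat) (lam : mpartition) (q : nat)
    (y : 'M[R[i]]_(q, ncols r lam)) i (k : 'I_(mult lam i)) :
    'M[R[i]]_(q, jdim r (psize lam i)) :=
  submxrow (submxrow y i) k.

Lemma J_group_toeplitz (R : realType) (r p : nat) (y : 'M[R[i]]_(r, jdim r p))
    (o : 'I_p) : o = 0%N :> nat -> submxrow y o \in unitmx -> J_group (toeplitz y).
Proof.
move=> o0 yU; exists (fun n => oapp (submxrow y) 0 (insub n)).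
  by rewrite /= -o0 valK.
apply: eq_mxblock => a b; case: ifP => // _.
by have -> : (b - a)%N = ord_sub b a by []; rewrite valK.
Qed.

Lemma diag_block_iota_inv (R : realType) (r : nat) (lam : mpartition)
    (y : 'M[R[i]]_(r, ncols r lam)) i (k : 'I_(mult lam i)) :
  diag_block (iota_inv y) k = toeplitz (jrow y k).
Proof. exact: diag_blockE. Qed.

Lemma jentry_iota_inv0 (R : realType) (r : nat) (lam : mpartition)
    (y : 'M[R[i]]_(r, ncols r lam)) i (k : 'I_(mult lam i)) :
  jentry (psize_gt0 i) (diag_block (iota_inv y) k) (ord_z i) =
  col_block y k (ord_z i).
Proof. by rewrite diag_block_iota_inv jentry_toeplitz. Qed.

(** [iota_inv] always returns block-Toeplitz matrices, so membership in H only asks that each h_0 be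
    invertible. *)
Lemma H_group_iota_inv (R : realType) (r : nat) (lam : mpartition)
    (y : 'M[R[i]]_(r, ncols r lam)) :
  H_group (iota_inv y) <->
  forall i (k : 'I_(mult lam i)), col_block y k (ord_z i) \in unitmx.
Proof.
split=> [[h hJ hE] i k|yU].
  rewrite -[y]iota_invK -hE /iota_H /col_block !mxrowK diag_blockE.
  by have [f fU <-] := hJ i k; rewrite /jentry mxblockK /= subn0.
exists (fun i k => toeplitz (jrow y k)) => // i k.
apply: (@J_group_toeplitz _ _ _ _ (ord_z i)) => //; exact: yU.
Qed.

(** The logarithms in the cover depend on h only through the det h_0, so they can be kept when the
    h_0 agree. *)
Lemma H_cover_transfer (R : realType) (r : nat) (lam : mpartition)
    (h h' : 'M[R[i]]_(ncols r lam)) (l : logs R lam) :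
  (H_group h -> H_group h') ->
  (forall i (k : 'I_(mult lam i)),
    jentry (psize_gt0 i) (diag_block h k) (ord_z i) =
    jentry (psize_gt0 i) (diag_block h' k) (ord_z i)) ->
  H_cover (h, l) -> H_cover (h', l).
Proof.
by move=> hh' hE [hH lE]; split=> [|i k]; [exact: hh'|rewrite lE /= hE].
Qed.

(** * Invariance of the domain, the cycles and the integrand under g *)

Section Radon.
Variables (R : realType) (r m : nat) (lam : mpartition).
Variables (al be : param R lam).
Variable c : forall i, 'I_(mult lam i) -> nat -> R[i].
Hypothesis c1 : forall i (k : 'I_(mult lam i)), (1 < psize lam i)%N -> c k 1%N != 0.
Hypothesis albe0 : forall i (k : 'I_(mult lam i)),
  al k (ord_z i) = be k (ord_z i).
Hypothesis albe : forall i (k : 'I_(mult lam i)) (a : 'I_(psize lam i)),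
  (0 < a)%N -> \sum_(b < psize lam i) mu (psize lam i) (c k) a b * al k b = be k a.

(** The element g. The identities below compare (zg, alpha) with (z, beta), which keeps the inverse
    of g out of them. *)
Definition subst_mx : 'M[R[i]]_(ncols r lam) :=
  \mxdiag_(i < nparts lam) \mxdiag_(k < mult lam i)
    mu_mx r (psize lam i) (c k).

Lemma subst_mx_U : U_group subst_mx.
Proof.
exists (fun i k => mu_mx r (psize lam i) (c k)) => // i k.
by exists (c k) => //; exact: c1.
Qed.

Lemma subst_mx_unit : subst_mx \in unitmx.
Proof.
apply: mxdiag_unitmx => i; apply: mxdiag_unitmx => k; apply: mu_mx_unit.
exact: c1.
Qed.

Lemma jrow_subst_mx q (y : 'M[R[i]]_(q, ncols r lam)) i k :
  jrow (y *m subst_mx) k = jrow y k *m mu_mx r (psize lam i) (c k).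
Proof. by rewrite /jrow !submxrow_mul_mxdiag. Qed.

(** The substitution fixes the constant term of y(w). Hence X_z and the determinants whose
    logarithms are chosen are the same for z and zg. *)
Lemma col_block0_subst_mx q (y : 'M[R[i]]_(q, ncols r lam)) i k :
  col_block (y *m subst_mx) k (ord_z i) = col_block y k (ord_z i).
Proof.
by rewrite -[LHS]/(submxrow (jrow _ k) _) jrow_subst_mx submxrow_mu_mx0.
Qed.

Implicit Type y : 'M[R[i]]_(r, ncols r lam).

Lemma diag_block_subst_mx y i k :
  diag_block (iota_inv (y *m subst_mx)) k =
  toeplitz (jrow y k *m mu_mx r (psize lam i) (c k)).
Proof. by rewrite diag_block_iota_inv jrow_subst_mx. Qed.

Lemma jexponent_subst_mx y i k :
  jexponent (psize_gt0 i) (diag_block (iota_inv (y *m subst_mx)) k) (al k) =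
  jexponent (psize_gt0 i) (diag_block (iota_inv y) k) (be k).
Proof.
(* An unrestricted rewrite also compares [y *m subst_mx] with [y], and that
   unification unfolds the block matrices without end. *)
rewrite [in LHS]diag_block_subst_mx [in RHS]diag_block_iota_inv.
by apply: jexponent_mu_mx; exact: albe.
Qed.

Lemma exponent_subst_mx y :
  exponent (iota_inv (y *m subst_mx)) al = exponent (iota_inv y) be.
Proof.
by apply: eq_bigr => i _; apply: eq_bigr => k _; apply: jexponent_subst_mx.
Qed.

Lemma chi_subst_mx y (l : logs R lam) :
  chi (iota_inv (y *m subst_mx), l) al = chi (iota_inv y, l) be.
Proof.
apply: eq_bigr => i _; apply: eq_bigr => k _; rewrite /chi_J /=.
(* The power factors agree because alpha_0 = beta_0 and the logarithm is shared. *)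
exact: (congr2 (fun x t => cexp (x * l i k) * cexp t) (albe0 k)
  (jexponent_subst_mx y k)).
Qed.

Lemma jentry0_subst_mx y i (k : 'I_(mult lam i)) :
  jentry (psize_gt0 i) (diag_block (iota_inv (y *m subst_mx)) k) (ord_z i) =
  jentry (psize_gt0 i) (diag_block (iota_inv y) k) (ord_z i).
Proof.
rewrite [in LHS]jentry_iota_inv0 [in RHS]jentry_iota_inv0.
exact: col_block0_subst_mx.
Qed.

Lemma H_group_subst_mx y :
  H_group (iota_inv (y *m subst_mx)) <-> H_group (iota_inv y).
Proof.
split=> /H_group_iota_inv yU; apply/H_group_iota_inv => i k; have := yU i k.
  by rewrite [X in X \in _ -> _]col_block0_subst_mx.
by rewrite [X in _ -> X \in _]col_block0_subst_mx.
Qed.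

Lemma H_cover_subst_mx y (l : logs R lam) :
  H_cover (iota_inv (y *m subst_mx), l) <-> H_cover (iota_inv y, l).
Proof.
split; apply: H_cover_transfer => [|i k].
- exact: (H_group_subst_mx y).1.
- exact: jentry0_subst_mx.
- exact: (H_group_subst_mx y).2.
- exact/esym/jentry0_subst_mx.
Qed.

Lemma in_X_subst_mx (z : 'M[R[i]]_(m, ncols r lam)) :
  in_X (z *m subst_mx) = in_X z.
Proof.
apply/funext => t; apply/propext.
by split=> tX i k; have := tX i k; rewrite col_block0_subst_mx.
Qed.

Lemma gfun_subst_mx (z : 'M[R[i]]_(m, ncols r lam)) :
  gfun (z *m subst_mx) al = gfun z be.
Proof.
apply/funext => t; rewrite /gfun [in LHS]mulmxA; exact: exponent_subst_mx.
Qed.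

Lemma chi_branch_subst_mx (z : 'M[R[i]]_(m, ncols r lam)) :
  chi_branch (z *m subst_mx) al = chi_branch z be.
Proof.
apply/funext => d; apply/funext => j; apply/funext => s.
by rewrite /chi_branch [in LHS]mulmxA; exact: chi_subst_mx.
Qed.

Lemma is_chain_subst_mx (z : 'M[R[i]]_(m, ncols r lam)) :
  is_chain (z *m subst_mx) al = is_chain z be.
Proof.
apply/funext => d; rewrite /is_chain /Phi /Xset in_X_subst_mx gfun_subst_mx.
have coverE j s : H_cover (iota_inv (frame_mx (sframe d j s) *m (z *m subst_mx)),
      slogs d j s) <->
    H_cover (iota_inv (frame_mx (sframe d j s) *m z), slogs d j s).
  by rewrite [in X in X <-> _]mulmxA; exact: H_cover_subst_mx.
(* Local finiteness and supports now coincide literally; only the cover condition differs, and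
   [coverE] settles it. *)
apply/propext; split=> -[simplexP locfin supp]; split; [|exact: locfin|exact: supp
  | |exact: locfin|exact: supp] => j /simplexP[C1 inX clogs];
  (split; [exact: C1| |exact: clogs]) => s /inX[Xs Hs]; (split; first exact: Xs).
  exact: (coverE j s).1.
exact: (coverE j s).2.
Qed.

(** Besides [is_chain], z enters only through [chi_branch]; the transport factors depend on frames
    alone. *)
Lemma is_cycle_subst_mx (z : 'M[R[i]]_(m, ncols r lam)) :
  is_cycle (z *m subst_mx) al = is_cycle z be.
Proof.
by apply/funext => d; rewrite /is_cycle is_chain_subst_mx chi_branch_subst_mx.
Qed.

Lemma simplex_term_subst_mx (z : 'M[R[i]]_(m, ncols r lam)) :
  simplex_term (z *m subst_mx) al = simplex_term z be.
Proof.
apply/funext => d; apply/funext => j.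
by rewrite /simplex_term chi_branch_subst_mx.
Qed.

Lemma Zset_subst_mx (z : 'M[R[i]]_(m, ncols r lam)) :
  Zset (z *m subst_mx) <-> Zset z.
Proof.
rewrite /Zset /= mxrankMfree ?row_free_unit ?subst_mx_unit//.
by split=> -[zm z0]; split=> // i k; have := z0 i k; rewrite col_block0_subst_mx.
Qed.

Lemma transforms_to_subst_mx : transforms_to r m al be.
Proof.
exists subst_mx; first exact: subst_mx_U.
move=> z zZ; pose z' := z *m invmx subst_mx.
(* Writing z = z'g puts the goal in the form of the identities above. *)
have zE : z = z' *m subst_mx by rewrite mulmxKV// subst_mx_unit.
rewrite -/z' {}zE in zZ *; split; first exact/Zset_subst_mx.
  by rewrite /Xset in_X_subst_mx.
move=> d; split=> [|_].
  by rewrite [in X in X <-> _]is_cycle_subst_mx.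
rewrite /RHF_cvg /RHF; split.
  by rewrite [in X in X <-> _]simplex_term_subst_mx.
by rewrite [in LHS]simplex_term_subst_mx.
Qed.

End Radon.

(** * Choice of the substitutions and the normal form *)

Lemma transforms_to_eq0 (R : realType) (r m : nat) (lam : mpartition)
    (al be : param R lam) :
  param_cond m al -> param_cond m be ->
  (forall i (k : 'I_(mult lam i)), al i k (ord_z i) = be i k (ord_z i)) ->
  transforms_to r m al be.
Proof.
move=> [_ al1 _] [_ be1 _] albe0.
have solve i (k : 'I_(mult lam i)) : exists c : nat -> R[i],
    ((1 < psize lam i)%N -> c 1%N != 0) /\
    forall a : 'I_(psize lam i), (0 < a)%N ->
      \sum_(b < psize lam i) mu (psize lam i) c a b * al i k b = be i k a.
  (* If n_i = 1 there is no index a > 0, and any c will do. *)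
  have [p1|p1] := ltnP 1 (psize lam i); last first.
    by exists (fun=> 0); split=> // a; have := ltn_ord a; lia.
  pose ext (f : 'I_(psize lam i) -> R[i]) n := oapp f 0 (insub n).
  have extE f (a : 'I_(psize lam i)) : ext f a = f a by rewrite /ext valK.
  have lt_last : ((psize lam i).-1 < psize lam i)%N by lia.
  have [||c c1 cE] := @mu_solve R (psize lam i) (ext (al i k)) (ext (be i k)) p1.
  - by rewrite (extE _ (Ordinal lt_last)) al1.
  - by rewrite (extE _ (Ordinal lt_last)) be1.
  exists c; split=> // a a0.
  rewrite -[RHS]extE -cE ?a0 ?ltn_ord//.
  by apply: eq_bigr => b _; rewrite extE.
(* One choice over all pairs (i, k), taken as dependent pairs because the range of k depends on
   i. *)
have [c cP] := choice (fun ik : {i & 'I_(mult lam i)} => solve (tag ik) (tagged ik)).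
apply: (@transforms_to_subst_mx _ _ _ _ _ _ (fun i k => c (Tagged _ k))) => // i k.
- exact: (cP (Tagged _ k)).1.
- exact: (cP (Tagged _ k)).2.
Qed.

(** Conditions (i) and (iii) see only the entries alpha_0, which are kept; the last entry 1 gives
    (ii). *)
Lemma normal_param_cond (R : realType) (m : nat) (lam : mpartition)
    (al : param R lam) : param_cond m al -> param_cond m (normal_param al).
Proof.
move=> [al0 _ al_sum]; split=> [i k q|i k a p2 aE|].
- exact: al0.
(* The last index is not 0 as n_i >= 2, so the test for index 0 fails. *)
- rewrite /normal_param aE eqxx ifF ?oner_eq0//; lia.
- exact: al_sum.
Qed.

Theorem proposition4p6 (R : realType) (r n m : nat) (lam : mpartition)
    (r_gt0 : (0 < r)%N) (n_gt0 : (0 < n)%N) (lam_n : weight lam = n)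
    (r_lt_m : (r < m)%N) (m_lt_N : (m < n * r)%N)
    (alpha : param R lam) (alpha_cond : param_cond m alpha) :
  (forall beta : param R lam,
     param_cond m beta ->
     (forall i (k : 'I_(mult lam i)),
        alpha i k (ord_z i) = beta i k (ord_z i)) ->
     transforms_to r m alpha beta) /\
  [/\ param_cond m (normal_param alpha),
      forall i (k : 'I_(mult lam i)),
        alpha i k (ord_z i) = normal_param alpha i k (ord_z i) &
      transforms_to r m alpha (normal_param alpha)].
Proof.
split=> [beta beta_cond|]; first exact: transforms_to_eq0.
have normal_cond := normal_param_cond alpha_cond.
by split=> //; apply: transforms_to_eq0.
Qed.
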